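(* Let $G=(G'_\ell,A'_\ell,B'_\ell)\circ(G'_{\ell-1},A'_{\ell-1},B'_{\ell-1})\circ\cdots\circ(G'_1,A'_1,B'_1)\circ G'_0$ be the compact canonical decomposition of a graph $G$. Then every automorphism $\pi$ of $G$ satisfies $\pi(V(G'_i))=V(G'_i)$ for every $i=0,\dots,\ell$, and the map $\pi\mapsto(\pi|_{V(G'_\ell)},\dots,\pi|_{V(G'_0)})$ is a group isomorphism $$\mathrm{Aut}(G)\cong\mathrm{Aut}(G'_\ell)\times\mathrm{Aut}(G'_{\ell-1})\times\cdots\times\mathrm{Aut}(G'_1)\times\mathrm{Aut}(G'_0);$$ in particular, any choice of automorphisms $\pi_i\in\mathrm{Aut}(G'_i)$ combines into an automorphism of $G$.
   Context: All graphs are finite and simple; $\mathrm{Aut}(G)$ is the group of automorphisms (adjacency-preserving bijections $V(G)\to V(G)$). A graph is split if its vertex set can be partitioned into $A$ (inducing a complete graph) and $B$ (inducing an independent set), either possibly empty; $(A,B)$ is a $KS$-partition. For split $(G,A,B)$ with $V(G)\neq\emptyset$ and a graph $H$, $V(H)\neq\emptyset$, on disjoint vertices, $(G,A,B)\circ H$ is the graph on $V(G)\cup V(H)$ with edge set $E(G)\cup E(H)\cup\{uv:u\in A,v\in V(H)\}$; this is associative and iterated compositions are read right-nested. A graph is indecomposable if it is not isomorphic to any such composition. Canonical decomposition (Tyshkevich): every graph is $G=(G_k,A_k,B_k)\circ\cdots\circ(G_1,A_1,B_1)\circ G_0$ with every $G_i$ indecomposable, unique up to componentwise isomorphism. A single-vertex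 component $(G_i,A_i,B_i)$, $i\ge1$, has type $K_1$ if $A_i=V(G_i)$ and type $S_1$ if $B_i=V(G_i)$; if $G_0$ and $G_1$ are both single-vertex graphs, $G_0$ is assigned the type of $G_1$. The compact canonical decomposition is obtained from the canonical decomposition by replacing each maximal run of consecutive single-vertex components of the same type by a single component: a run of $m$ components of type $K_1$ is replaced by the complete graph $K_m$ with $KS$-partition $(V(K_m),\emptyset)$, and a run of $m$ components of type $S_1$ by the edgeless graph on $m$ vertices with $KS$-partition $(\emptyset,\text{all vertices})$ (if the run contains $G_0$, the replacement becomes the new last component $G'_0$). It is unique up to isomorphism, and each component is an indecomposable graph with at least two vertices, a complete graph, or an edgeless graph. *)

(* Defs.v *)
From mathcomp Require Import all_boot all_fingroup.
Set Implicit Arguments. Unset Strict Implicit. Unset Printing Implicit Defensive.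

(* A finite simple graph G is a symmetric irreflexive relation e on a finType T;
   V(G) = T.  All decompositions are represented *internally*: components are
   induced subgraphs G[V_i] on the blocks V_i of a partition of T. *)

Section Graphs.
Variable T : finType.
Variable e : rel T.

Definition clique (A : {set T}) :=
  [forall x in A, forall y in A, (x != y) ==> e x y].
Definition indep (B : {set T}) :=
  [forall x in B, forall y in B, ~~ e x y].

Definition ks_part (V A B : {set T}) :=
  [&& A :&: B == set0, A :|: B == V, clique A & indep B].

(* G[V] is isomorphic to a composition (G[X],A,B) o G[Y]:
   V = X disjoint-union Y, both nonempty, (A,B) a KS-partition of G[X],
   and for u in X, v in Y: uv is an edge iff u \in A. *)
Definition decomposable_on (V : {set T}) :=
  exists X A B Y : {set T},
    [&& X :&: Y == set0, X :|: Y == V, X != set0, Y != set0, ks_part X A B &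
        [forall u in X, forall v in Y, e u v == (u \in A)]].

Definition indecomposable_on (V : {set T}) := ~ decomposable_on V.

(* A decomposition G = (G_k,A_k,B_k) o ... o (G_1,A_1,B_1) o G_0 is given by
   comps = [:: (A_1,B_1); ...; (A_k,B_k)] (V(G_i) = A_i :|: B_i) and V0 = V(G_0). *)
Definition parts (comps : seq ({set T} * {set T})) (V0 : {set T}) : seq {set T} :=
  V0 :: [seq p.1 :|: p.2 | p <- comps].

Definition is_decomp (comps : seq ({set T} * {set T})) (V0 : {set T}) :=
  [/\ all (fun V => V != set0) (parts comps V0),
      all (fun p => ks_part (p.1 :|: p.2) p.1 p.2) comps,
      (forall x : T, count (fun V : {set T} => x \in V) (parts comps V0) = 1%N) &
      (forall i j : nat, (j < i < size (parts comps V0))%N ->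
         forall u v : T, u \in nth set0 (parts comps V0) i ->
                         v \in nth set0 (parts comps V0) j ->
         e u v = (u \in (nth (set0, set0) comps i.-1).1))].

Definition canonical_decomp (comps : seq ({set T} * {set T})) (V0 : {set T}) :=
  is_decomp comps V0 /\ forall V, V \in parts comps V0 -> indecomposable_on V.

(* Types of single-vertex components: Some true = K_1, Some false = S_1,
   None = untyped (at least two vertices, or G_0 not followed by a single vertex). *)
Definition comp_type (p : {set T} * {set T}) : option bool :=
  if #|p.1 :|: p.2| == 1%N then Some (p.1 == p.1 :|: p.2) else None.

Definition item := (option bool * ({set T} * {set T}))%type.

(* merge maximal runs of consecutive single-vertex components of the same type;
   a K-run becomes (union, set0) = (V(K_m), emptyset), an S-run (set0, union) *)
Fixpoint compress (s : seq item) : seq item :=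
  match s with
  | [::] => [::]
  | x :: s' =>
    match compress s' with
    | [::] => [:: x]
    | y :: ys =>
      if (x.1 != None) && (x.1 == y.1)
      then (x.1, (x.2.1 :|: y.2.1, x.2.2 :|: y.2.2)) :: ys
      else x :: y :: ys
    end
  end.

Definition type0 (comps : seq ({set T} * {set T})) (V0 : {set T}) : option bool :=
  if #|V0| == 1%N then
    (if comps is p :: _ then comp_type p else None)
  else None.

(* items for G_0, G_1, ..., G_k (G_0 stored as (V0, set0); only its vertex set matters) *)
Definition items (comps : seq ({set T} * {set T})) (V0 : {set T}) : seq item :=
  (type0 comps V0, (V0, set0)) :: [seq (comp_type p, p) | p <- comps].

Definition compact_parts (comps : seq ({set T} * {set T})) (V0 : {set T}) : seq {set T} :=
  [seq x.2.1 :|: x.2.2 | x <- compress (items comps V0)].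

Definition graph_aut : {set {perm T}} :=
  [set p : {perm T} | [forall x, forall y, e (p x) (p y) == e x y]].

(* Aut(G[V]) realised as permutations of T supported on V *)
Definition aut_on (V : {set T}) : {set {perm T}} :=
  [set p : {perm T} | perm_on V p &&
     [forall x in V, forall y in V, e (p x) (p y) == e x y]].

End Graphs.

(* Main.v *)
(** Order the vertices by the level of their component in the canonical
    decomposition.  If u lies strictly above y, then the neighbourhoods of u and
    y are nested up to u and y themselves, so that equality of the degrees makes
    u and y twins.  Indecomposability then forces every component between the
    two to be a single vertex of one common type, whence u and y lie in the same
    compact component.  As automorphisms preserve degrees, they stabilise the
    compact components.  Conversely, an indecomposable graph with at least two
    vertices has at most one KS-partition, which its automorphisms therefore
    preserve; since the KS-partitions determine all the edges between distinct
    components, automorphisms of the compact components can be glued. *)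

Require Import Defs.
From mathcomp Require Import all_boot all_fingroup.
Set Implicit Arguments.
Unset Strict Implicit.
Unset Printing Implicit Defensive.

Lemma nth_find_count1 (U : Type) (x0 : U) (P : pred U) (s : seq U) (i : nat) :
  ~~ P x0 -> count P s = 1 -> P (nth x0 s i) = (i == find P s).
Proof.
move=> /negPf Px0; elim: s i => [|x s IHs] [|i] //=; case: ifP => // _.
  move=> [/eqP]; rewrite eqn0Ngt -has_count -all_predC => /(all_nthP x0) s_notP.
  have [le_si|lt_is] := leqP (size s) i; first by rewrite nth_default.
  exact/negbTE/s_notP.
by rewrite add0n eqSS; apply: IHs.
Qed.

(** * Runs and compression *)

Section Runs.

Variable U : eqType.
Implicit Types (a b : option U) (t : seq (option U)).

Definition same_run a b := (a != None) && (a == b).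

Definition run_index t i :=
  \sum_(0 <= j < i) ~~ same_run (nth None t j) (nth None t j.+1).

Lemma run_index0 t : run_index t 0 = 0.
Proof. exact: big_nil. Qed.

Lemma run_index_cons a t i :
  run_index (a :: t) i.+1 = ~~ same_run a (nth None t 0) + run_index t i.
Proof. by rewrite /run_index big_nat_recl. Qed.

Lemma leq_run_index t : {homo run_index t : i j / i <= j}.
Proof.
move=> i j le_ij; rewrite /run_index (big_cat_nat (n := i) (p := j)) //=.
exact: leq_addr.
Qed.

Lemma run_index_eqP t i j : i <= j ->
  reflect (forall l, i <= l < j -> same_run (nth None t l) (nth None t l.+1))
          (run_index t i == run_index t j).
Proof.
move=> le_ij; rewrite /run_index (big_cat_nat (n := i) (p := j)) //=.
rewrite -[X in X == _]addn0 eqn_add2l eq_sym sum_nat_seq_eq0.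
apply: (iffP allP) => [same l lij|same l]; last first.
  by rewrite mem_index_iota => /same->.
by have := same l; rewrite mem_index_iota eqb0 negbK; apply.
Qed.

Lemma run_index_const t (u : U) i j : i <= j ->
    (forall l, i <= l <= j -> nth None t l = Some u) ->
  run_index t i = run_index t j.
Proof.
move=> le_ij tu; apply/eqP/(run_index_eqP _ le_ij) => l /andP[le_il lt_lj].
have [tl tlS] : nth None t l = Some u /\ nth None t l.+1 = Some u.
  by rewrite !tu ?lt_lj ?le_il ?(leqW le_il) ?(ltnW lt_lj).
by rewrite /same_run tl tlS eqxx.
Qed.

Lemma run_index_nth t i j :
  run_index t i = run_index t j -> nth None t i = nth None t j.
Proof.
wlog le_ij : i j / i <= j => [wlog_le eq_ij|].
  by case: (leqP i j) => [/wlog_le|/ltnW/wlog_le->]; first exact.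
move/eqP/(run_index_eqP _ le_ij); elim: j le_ij => [|j IHj].
  by rewrite leqn0 => /eqP->.
rewrite leq_eqVlt => /predU1P[-> //|le_ij] same.
have /andP[_ /eqP<-] : same_run (nth None t j) (nth None t j.+1).
  by rewrite same // ltnSn andbT.
by apply: IHj => // l /andP[le_il lt_lj]; rewrite same // le_il ltnW.
Qed.

Lemma run_index_inj_None t i j :
  nth None t i = None -> run_index t i = run_index t j -> i = j.
Proof.
wlog lt_ij : i j / i < j => [wlog_lt ti eq_ij|ti].
  have tj : nth None t j = None by rewrite -(run_index_nth eq_ij).
  by case: (ltngtP i j) => // [/wlog_lt|/wlog_lt/(_ tj)->//]; apply.
move/eqP/(run_index_eqP _ (ltnW lt_ij))/(_ i).
by rewrite leqnn lt_ij /same_run ti => /(_ isT).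
Qed.

End Runs.

Section Compress.

Variable T : finType.
Implicit Types (s : seq (item T)) (cs : seq {set T}) (x : T).

Definition block_index cs x := find (fun V : {set T} => x \in V) cs.

Definition block_count cs x := count (fun V : {set T} => x \in V) cs.

Lemma mem_nth_block cs x i :
  block_count cs x = 1 -> (x \in nth set0 cs i) = (i == block_index cs x).
Proof.
move=> count1; apply: (nth_find_count1 (P := fun V : {set T} => x \in V)) => //.
by rewrite inE.
Qed.

Definition item_set (y : item T) : {set T} := y.2.1 :|: y.2.2.

Lemma item_set_merge a (y z : item T) :
  item_set (a, (y.2.1 :|: z.2.1, y.2.2 :|: z.2.2)) = item_set y :|: item_set z.
Proof. exact: setUACA. Qed.

Lemma nth0_type_compress s :
  nth None (map fst (compress s)) 0 = nth None (map fst s) 0.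
Proof. by case: s => //= y s; case: (compress s) => //= w ws; case: ifP. Qed.

Lemma block_index_compress s x :
  block_index (map item_set (compress s)) x =
  run_index (map fst s) (block_index (map item_set s) x).
Proof.
rewrite /block_index; elim: s => [|y s IHs]; first by rewrite run_index0.
have := nth0_type_compress s; rewrite [compress (y :: s)]/=.
case: (compress s) IHs => [|w ws] /= IHs type_s.
  case: ifP => _; first by rewrite run_index0.
  by rewrite run_index_cons -type_s -IHs /same_run; case: (y.1).
rewrite -/(same_run _ _) type_s; case: ifP => same /=.
  rewrite item_set_merge in_setU.
  case: (x \in item_set y) => /=; first by rewrite run_index0.
  by rewrite run_index_cons same -IHs.
case: (x \in item_set y); first by rewrite run_index0.
by rewrite run_index_cons same -IHs.
Qed.

Lemma block_count_compress s x : block_count (map item_set s) x <= 1 ->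
  block_count (map item_set (compress s)) x = block_count (map item_set s) x.
Proof.
rewrite /block_count; elim: s => //= y s IHs le1; move: (le1).
rewrite -{}IHs ?(leq_trans (leq_addl _ _) le1) //.
case: (compress s) => //= w ws; case: ifP => //= _.
rewrite item_set_merge in_setU.
by case: (x \in item_set y) (x \in item_set w) => [] [].
Qed.

End Compress.

(** * Permutations stabilising blocks *)

Section LocalAut.

Variables (T : finType) (e : rel T).
Implicit Types (V U : {set T}) (cs : seq {set T}) (p : {perm T}).

Definition local_aut V : {set {perm T}} :=
  [set p in 'N(V | 'P)%g |
    [forall x in V, forall y in V, e (p x) (p y) == e x y]].

Lemma local_autP V p :
  reflect ((forall x, (p x \in V) = (x \in V)) /\
           {in V &, forall x y, e (p x) (p y) = e x y})
          (p \in local_aut V).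
Proof.
rewrite inE; apply: (iffP andP) => -[pV pe]; split.
- exact/(astabsP pV).
- by move=> x y xV yV; have /forall_inP/(_ y yV)/eqP := forall_inP pe x xV.
- exact/astabsP.
by apply/forall_inP => x xV; apply/forall_inP => y yV; rewrite pe.
Qed.

Lemma group_set_local_aut V : group_set (local_aut V).
Proof.
apply/group_setP; split=> [|p q /local_autP[pV pe] /local_autP[qV qe]].
  by apply/local_autP; split=> [x|x y]; rewrite !perm1.
by apply/local_autP; split=> [x|x y xV yV]; rewrite !permM ?qV // qe ?pV ?pe.
Qed.
Canonical local_aut_group V := Group (group_set_local_aut V).

Lemma aut_onE V : aut_on e V = Sym V :&: local_aut V.
Proof.
apply/setP => p; rewrite [LHS]inE [RHS]inE [p \in Sym V]inE.
rewrite [p \in local_aut V]inE.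
apply: andb_id2l => pV; suff -> : p \in 'N(V | 'P)%g by [].
by apply/astabsP => x; apply: perm_closed.
Qed.

Lemma graph_autP p :
  reflect (forall x y, e (p x) (p y) = e x y) (p \in graph_aut e).
Proof.
rewrite inE; apply: (iffP forallP) => pe x.
  by move=> y; apply/eqP; move: y; apply/forallP.
by apply/forallP => y; rewrite pe.
Qed.

Lemma restr_perm_aut_on V p :
  p \in local_aut V -> restr_perm V p \in aut_on e V.
Proof.
move=> pV; have [stab_pV pe] := setIdP pV; rewrite inE restr_perm_on.
apply/forall_inP => x xV; apply/forall_inP => y yV.
by rewrite !restr_permE //; have /forall_inP/(_ y yV) := forall_inP pe x xV.
Qed.

Lemma perm_on_restrV_mul V U p : p \in 'N(V | 'P)%g -> perm_on (V :|: U) p ->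
  perm_on U ((restr_perm V p)^-1 * p)%g.
Proof.
move=> stab_pV pVU; have qV := perm_onV (restr_perm_on V p).
apply/subsetP => x; rewrite inE permM; apply: contraR => xU.
have [xV|xV] := boolP (x \in V).
  by rewrite -(restr_permE stab_pV) ?permKV ?perm_closed.
by rewrite (out_perm qV) // (out_perm pVU) // inE negb_or xV.
Qed.

Lemma SymS V U : V \subset U -> Sym V \subset Sym U.
Proof.
by move=> sVU; apply/subsetP => p; rewrite !inE => pV; apply: subset_trans sVU.
Qed.

Lemma SymT : Sym [set: T] = [set: {perm T}].
Proof. by apply/setP => p; rewrite !inE; apply/subsetP => x _; rewrite inE. Qed.

Lemma Sym_sub_local_aut V U : [disjoint V & U] -> Sym V \subset local_aut U.
Proof.
move=> dVU; apply/subsetP => p; rewrite inE => pV.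
have pU x : x \in U -> p x = x.
  by move=> xU; apply: out_perm pV _; rewrite (disjointFl dVU).
apply/local_autP; split=> [x|x y xU yU]; last by rewrite !pU.
apply/idP/idP => [pxU|xU]; last by rewrite pU.
by rewrite -(perm_inj (pU _ pxU)).
Qed.

Lemma cents_Sym V U : [disjoint V & U] -> Sym U \subset 'C(Sym V)%g.
Proof.
move=> dVU; apply/centsP => q qU p pV; rewrite !inE in qU pV.
exact/commute_sym/(perm_onC pV qU).
Qed.

Lemma Sym_disjointI V U : [disjoint V & U] -> Sym V :&: Sym U = 1%g.
Proof.
move=> dVU; apply/trivgP/subsetP => p; rewrite in_setI !inE => /andP[pV pU].
apply/eqP/permP => x; rewrite perm1; have [xV|xV] := boolP (x \in V).
  by apply: out_perm pU _; rewrite (disjointFr dVU).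
exact: out_perm pV xV.
Qed.

Lemma aut_on_dprod V U (K : {group {perm T}}) :
    [disjoint V & U] -> Sym V \subset K ->
  (aut_on e V \x (Sym U :&: K))%g = Sym (V :|: U) :&: (local_aut V :&: K).
Proof.
move=> dVU sVK; have sUV : Sym U \subset local_aut V.
  by apply: Sym_sub_local_aut; rewrite disjoint_sym.
rewrite aut_onE dprodE /=; first 1 last.
- apply: subset_trans (subsetIl _ _) _; apply: subset_trans (cents_Sym dVU) _.
  exact/centS/subsetIl.
- by apply/trivgP; rewrite -(Sym_disjointI dVU) setISS ?subsetIl.
apply/eqP; rewrite eqEsubset; apply/andP; split.
  rewrite mul_subG //= !subsetI !subsetIr ?andbT /=.
    by rewrite !subIset ?SymS ?subsetUl ?sVK.
  by rewrite !subIset ?SymS ?subsetUr ?sUV.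
apply/subsetP => p /setIP[]; rewrite inE => pVU /setIP[pV pK].
have := restr_perm_aut_on pV; rewrite aut_onE; set q := restr_perm V p => qV.
have qK : q \in K by rewrite (subsetP sVK) //; case/setIP: qV.
apply/mulsgP; exists q (q^-1 * p)%g; rewrite ?mulKVg //.
apply/setIP; split; last by rewrite groupM ?groupV.
by rewrite inE perm_on_restrV_mul //; case/setIdP: pV.
Qed.

Lemma bigdprod_aut_on cs :
    pairwise (fun V U : {set T} => [disjoint V & U]) cs ->
  (\big[dprod/1]_(V <- cs) aut_on e V)%g =
  Sym (\bigcup_(V <- cs) V) :&: \bigcap_(V <- cs) local_aut V.
Proof.
elim: cs => [_|V cs IHcs /=].
  apply/setP => p; rewrite !big_nil setIT !inE; apply/eqP/idP => [->|].
    exact: perm_on1.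
  by move/perm_on_id; apply; rewrite cards0.
case/andP=> /allP dV /IHcs eq_cs.
rewrite !big_cons {}eq_cs bigcup_seq bigcap_seq.
apply: aut_on_dprod.
  by apply/bigcup_disjointP => U /dV.
by apply/bigcapsP => U /dV; apply: Sym_sub_local_aut.
Qed.

End LocalAut.

(** * Indecomposable graphs *)

Section Indecomposable.

Variables (T : finType) (e : rel T).
Hypotheses (e_sym : symmetric e) (e_irr : irreflexive e).
Implicit Types (V W A B X Y : {set T}) (p : {perm T}).

Lemma ks_partP V A B :
  reflect [/\ A \subset V, B = V :\: A,
              {in A &, forall x y, x != y -> e x y} &
              {in V :\: A &, forall x y, e x y = false}]
          (ks_part e V A B).
Proof.
apply: (iffP and4P) => [[/eqP dAB /eqP<-]|[sAV ->]] cliqueA indepB.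
  have diffA : (A :|: B) :\: A = B.
    by rewrite setDUl setDv set0U; apply/setDidPl; rewrite -setI_eq0 setIC dAB.
  rewrite diffA subsetUl; split=> // x y xV yV.
    by have /forall_inP/(_ y yV)/implyP := forall_inP cliqueA x xV.
  by have /forall_inP/(_ y yV)/negbTE := forall_inP indepB x xV.
split.
- by rewrite setIDA setDIl setDv set0I.
- by rewrite -{1}(setIidPr sAV) setID.
- by apply/forall_inP => x xA; apply/forall_inP => y yA; apply/implyP/cliqueA.
by apply/forall_inP => x xB; apply/forall_inP => y yB; rewrite indepB.
Qed.

Lemma ks_partD V W A B :
  ks_part e V A B -> ks_part e (V :\: W) (A :\: W) (B :\: W).
Proof.
case/ks_partP => sAV -> cliqueA indepB; apply/ks_partP; split.
- exact: setSD.
- by apply/setP => x; rewrite !inE; case: (x \in W).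
- by move=> x y /setDP[xA _] /setDP[yA _]; apply: cliqueA.
move=> x y; rewrite !inE => /andP[xA /andP[xW xV]] /andP[yA /andP[yW yV]].
by rewrite xW yW in xA yA; apply: indepB; rewrite inE ?xA ?yA.
Qed.

Lemma ks_part_set1 x (b : bool) :
  ks_part e [set x] (if b then [set x] else set0) (if b then set0 else [set x]).
Proof.
apply/ks_partP; split.
- by case: b; rewrite ?sub0set.
- by case: b; rewrite ?setDv ?setD0.
- by case: b => y z /=; rewrite !inE // => /eqP-> /eqP->; rewrite eqxx.
by move=> y z /setDP[/set1P-> _] /setDP[/set1P-> _].
Qed.

Lemma indecomposable_composition V X Y A B :
    indecomposable_on e V -> V = X :|: Y -> X :&: Y = set0 -> ks_part e X A B ->
    {in X & Y, forall u v, e u v = (u \in A)} ->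
  X = set0 \/ Y = set0.
Proof.
move=> indV VE dXY ksX eXY; have [->|X0] := eqVneq X set0; first by left.
have [->|Y0] := eqVneq Y set0; first by right.
case: indV; exists X, A, B, Y; rewrite dXY -VE !eqxx X0 Y0 ksX /=.
by apply/forall_inP => u uX; apply/forall_inP => v vY; rewrite eXY.
Qed.

Lemma indecomposable_uniform V y (b : bool) :
    indecomposable_on e V -> y \in V -> {in V, forall z, z != y -> e y z = b} ->
  V = [set y].
Proof.
move=> indV yV yb; have VE := setD1K yV.
have dyV : [set y] :&: (V :\ y) = set0 by rewrite setIDA setDIl setDv set0I.
have ks_y := ks_part_set1 y b.
have [|Y0|V0] := indecomposable_composition indV (esym VE) dyV ks_y.
- move=> u v /set1P-> /setD1P[vy vV]; rewrite yb //.
  by case: (b); rewrite inE ?eqxx.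
- by have := set11 y; rewrite Y0 inE.
by rewrite -VE V0 setU0.
Qed.

Lemma indecomposable_nbhd_clique V A B u :
    indecomposable_on e V -> ks_part e V A B -> u \in V ->
    {in V, forall z, z != u -> e u z = (z \in A)} ->
  V = [set u].
Proof.
move=> indV ksV uV uA; have VE := setD1K uV.
have dVu : (V :\ u) :&: [set u] = set0 by rewrite setIDAC setDIl setDv setI0.
have VE' : V = (V :\ u) :|: [set u] by rewrite setUC.
have [|V0|u0] := indecomposable_composition indV VE' dVu (ks_partD [set u] ksV).
- by move=> z v /setD1P[zu zV] /set1P->; rewrite e_sym uA // !inE zu.
- by rewrite -VE V0 setU0.
by have := set11 u; rewrite u0 inE.
Qed.

Lemma indecomposable_ks_unique V A B A' B' :
    indecomposable_on e V -> 1 < #|V| -> ks_part e V A B -> ks_part e V A' B' ->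
  A = A'.
Proof.
(* No vertex is adjacent to exactly the rest of A.  So a vertex x of A outside
   A' has a neighbour z outside A; but then z lies in A', hence is adjacent to
   exactly A: to x by choice, and to the rest of A because that lies in A'. *)
move=> indV gt1V ksA ksA'; apply/eqP; rewrite eqEsubset.
wlog suff: A B A' B' ksA ksA' / A \subset A'.
  by move=> sub; rewrite (sub A B A' B') ?(sub A' B' A B).
have nbhd_neqA u : u \in V -> ~ {in V, forall z, z != u -> e u z = (z \in A)}.
  move=> uV /(indecomposable_nbhd_clique indV ksA uV) V_single.
  by rewrite V_single cards1 in gt1V.
have /ks_partP[sAV _ cliqueA indepB] := ksA.
have /ks_partP[_ _ cliqueA' indepB'] := ksA'.
apply/subsetP => x xA; apply: contraT => xA'; have xV := subsetP sAV x xA.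
have xB' : x \in V :\: A' by rewrite inE xA'.
case: (nbhd_neqA x xV) => z zV zx.
have [zA|zA] := boolP (z \in A); first by rewrite cliqueA // eq_sym.
have [zA'|zA'] := boolP (z \in A'); last by rewrite indepB' // inE zA'.
apply/negP => exz; case: (nbhd_neqA z zV) => w wV wz.
have [wA|wA] := boolP (w \in A); last by rewrite indepB // inE ?zA ?wA.
have [->|wx] := eqVneq w x; first by rewrite e_sym.
apply: cliqueA' => //; last by rewrite eq_sym.
apply: contraT => wA'; have := cliqueA w x wA xA wx.
by rewrite indepB' // inE wA'.
Qed.

Lemma ks_part_preim V A B p : p \in local_aut e V -> ks_part e V A B ->
  ks_part e V (p @^-1: A) (p @^-1: B).
Proof.
case/local_autP=> pV pe /ks_partP[sAV -> cliqueA indepB].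
have sApV x : p x \in A -> x \in V by move/(subsetP sAV); rewrite pV.
apply/ks_partP; split.
- by apply/subsetP => x; rewrite inE; apply: sApV.
- by apply/setP => x; rewrite !inE pV.
- move=> x y; rewrite !inE => pxA pyA xy.
  by rewrite -pe ?sApV // cliqueA // (inj_eq perm_inj).
move=> x y; rewrite !inE => /andP[pxA xV] /andP[pyA yV].
by rewrite -pe // indepB // inE ?pxA ?pyA pV.
Qed.

Lemma indecomposable_aut_ks V A B p :
    indecomposable_on e V -> ks_part e V A B -> p \in local_aut e V ->
  {in V, forall x, (p x \in A) = (x \in A)}.
Proof.
move=> indV ksV pV x xV; have [le1V|gt1V] := leqP #|V| 1.
  have [stab_pV _] := local_autP _ _ _ pV.
  by rewrite (card_le1_eqP le1V x (p x)) ?stab_pV.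
have ks_preim := ks_part_preim pV ksV.
by rewrite {2}(indecomposable_ks_unique indV gt1V ksV ks_preim) inE.
Qed.

End Indecomposable.

(** * Degrees and twins *)

Section Twins.

Variables (T : finType) (e : rel T).
Hypotheses (e_sym : symmetric e) (e_irr : irreflexive e).

Definition nbhd x : {set T} := [set z | e x z].

Definition twins x y := forall z, z != x -> z != y -> e x z = e y z.

Lemma twinsC x y : twins x y -> twins y x.
Proof. by move=> xy z zy zx; rewrite xy. Qed.

Lemma nested_nbhd_twins x y : (forall z, z != x -> z != y -> e x z -> e y z) ->
  #|nbhd x| = #|nbhd y| -> twins x y.
Proof.
move=> nested eq_deg.
have eq_card : #|nbhd x :\ y| = #|nbhd y :\ x|.
  apply/eqP; rewrite -(eqn_add2l (y \in nbhd x)) -cardsD1 eq_deg (cardsD1 x).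
  by rewrite !inE e_sym.
have sub : nbhd x :\ y \subset nbhd y :\ x.
  apply/subsetP => z; rewrite !inE => /andP[zy xz].
  have zx : z != x by apply: contraTneq xz => ->; rewrite e_irr.
  by rewrite zx nested.
have /eqP/setP eq_nbhd : nbhd x :\ y == nbhd y :\ x.
  by rewrite eqEcard sub eq_card leqnn.
by move=> z zx zy; have := eq_nbhd z; rewrite !inE zx zy.
Qed.

Lemma card_nbhd_aut p x : p \in graph_aut e -> #|nbhd (p x)| = #|nbhd x|.
Proof.
move/graph_autP=> pe; rewrite -(card_imset (nbhd x) (@perm_inj _ p)).
apply: eq_card => z; rewrite -[z](permKV p) mem_imset; last exact: perm_inj.
by rewrite !inE pe.
Qed.

End Twins.

(** * Levels of a decomposition *)

Section Decomposition.

Variables (T : finType) (e : rel T).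
Hypotheses (e_sym : symmetric e) (e_irr : irreflexive e).
Variables (comps : seq ({set T} * {set T})) (V0 : {set T}).
Hypothesis decomp : is_decomp e comps V0.
Implicit Types (u x y z : T) (i j : nat).

Notation part := (nth set0 (parts comps V0)).
Notation compact_part := (nth set0 (compact_parts comps V0)).
(* Meaningful for positive i only: G_0 carries no KS-partition, and the
   truncated predecessor returns that of G_1. *)
Notation ks_pair i := (nth (set0, set0) comps i.-1).
Notation level_type := (nth None (map fst (items comps V0))).

Definition level x := block_index (parts comps V0) x.

Definition in_clique x := x \in (ks_pair (level x)).1.

Lemma mem_part x i : (x \in part i) = (i == level x).
Proof. by have [_ _ cnt _] := decomp; apply/mem_nth_block/cnt. Qed.

Lemma in_part x : x \in part (level x). Proof. by rewrite mem_part. Qed.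

Lemma level_lt x : level x < size (parts comps V0).
Proof. by rewrite -has_find has_count; have [_ _ ->] := decomp. Qed.

Lemma level_surj i : i < size (parts comps V0) -> exists x, level x = i.
Proof.
move=> lt_i; have [/allP ne _ _ _] := decomp.
have /set0Pn[x] := ne _ (mem_nth set0 lt_i).
by rewrite mem_part => /eqP->; exists x.
Qed.

Lemma neq_level x z : level x != level z -> x != z.
Proof. by apply: contraNneq => ->. Qed.

Lemma edge_below x y : level y < level x -> e x y = in_clique x.
Proof.
have [_ _ _ edge] := decomp => lt_yx.
by rewrite (edge _ _ _ x y (in_part x) (in_part y)) // lt_yx level_lt.
Qed.

Lemma part_levelE x :
  0 < level x ->
  part (level x) = (ks_pair (level x)).1 :|: (ks_pair (level x)).2.
Proof.
have := level_lt x; rewrite /= size_map; case: (level x) => // i lt_i _.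
by rewrite /= (nth_map (set0, set0)).
Qed.

Lemma ks_part_level x : 0 < level x ->
  ks_part e (part (level x)) (ks_pair (level x)).1 (ks_pair (level x)).2.
Proof.
have [_ /allP ks _ _] := decomp => x_gt0; rewrite part_levelE //.
apply/ks/mem_nth; rewrite prednK //.
by have := level_lt x; rewrite /= size_map.
Qed.

Lemma edge_level x y : 0 < level x -> level x = level y -> x != y ->
  in_clique x = in_clique y -> e x y = in_clique x.
Proof.
move=> x_gt0 eq_xy xy; rewrite /in_clique -eq_xy.
have /ks_partP[_ _ cliqueA indepB] := ks_part_level x_gt0 => eqA.
have [xA|xA] := boolP (x \in _); first by rewrite cliqueA // -eqA.
by apply: indepB; rewrite inE -?eqA xA ?in_part // eq_xy in_part.
Qed.

Lemma edge_in_clique_or_eq u y z : level y < level u -> z != u ->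
  e u z = in_clique u \/ e u z = e y z.
Proof.
move=> lt_yu zu.
case: (ltngtP (level z) (level u)) => [/edge_below->|lt_uz|eq_zu].
- by left.
- by right; rewrite ![e _ z]e_sym !edge_below // (ltn_trans lt_yu).
have [eq_in|neq_in] := eqVneq (in_clique u) (in_clique z).
  by left; rewrite edge_level // 1?eq_sym //; apply: leq_ltn_trans lt_yu.
have -> : e y z = in_clique z by rewrite e_sym edge_below ?eq_zu.
by case: (e u z) (in_clique u) (in_clique z) neq_in => [] [] [] // _;
  [left | right | right | left].
Qed.

Lemma eq_degree_twins u y :
  level y < level u -> #|nbhd e u| = #|nbhd e y| -> twins e u y.
Proof.
move=> lt_yu eq_deg; have alt z zu := @edge_in_clique_or_eq u y z lt_yu zu.
have [u_in|u_notin] := boolP (in_clique u); last first.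
  apply: nested_nbhd_twins => // z zu _; case: (alt z zu) => -> //.
  by rewrite (negPf u_notin).
by apply: twinsC; apply: nested_nbhd_twins => // z _ zu; case: (alt z zu) => ->.
Qed.

Lemma level_typeE x : 0 < level x ->
  level_type (level x) = comp_type (ks_pair (level x)).
Proof.
have := level_lt x; rewrite /= size_map; case: (level x) => // i lt_i _.
by rewrite /= -map_comp (nth_map (set0, set0)).
Qed.

Lemma level_type_singleton x : 0 < level x -> part (level x) = [set x] ->
  level_type (level x) = Some (in_clique x).
Proof.
move=> x_gt0 part_x; rewrite level_typeE // /comp_type -part_levelE //.
rewrite part_x cards1 eqxx; congr Some; apply/eqP/idP => [eqA|xA].
  by rewrite /in_clique eqA set11.
apply/eqP; rewrite eqEsubset sub1set [x \in _]xA andbT.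
by rewrite -part_x part_levelE ?subsetUl.
Qed.

Lemma typed_level_singleton x b :
  0 < level x -> level_type (level x) = Some b -> part (level x) = [set x].
Proof.
move=> x_gt0; rewrite level_typeE // /comp_type -part_levelE //.
case: ifP => // /cards1P[y part_y] _.
by have := in_part x; rewrite part_y => /set1P->.
Qed.

Lemma level_type_in_clique x b :
  0 < level x -> level_type (level x) = Some b -> in_clique x = b.
Proof.
move=> x_gt0 tx; move: (tx); rewrite (level_type_singleton x_gt0) => [[]//|].
exact: typed_level_singleton tx.
Qed.

Lemma level_type0 y : part 0 = [set y] -> level_type 0 = level_type 1.
Proof. by rewrite /= /type0 => ->; rewrite cards1 eqxx; case: (comps). Qed.

Hypothesis indec : forall V, V \in parts comps V0 -> indecomposable_on e V.

Lemma indecomposable_level x : indecomposable_on e (part (level x)).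
Proof. exact/indec/mem_nth/level_lt. Qed.

Section TwinLevels.

Variables u y : T.
Hypotheses (lt_yu : level y < level u) (twins_uy : twins e u y).

Lemma twins_upper_singleton : part (level u) = [set u].
Proof.
have ks_u := ks_part_level (leq_ltn_trans (leq0n _) lt_yu).
apply: (indecomposable_nbhd_clique e_sym _ ks_u (in_part u)) => [|z].
  exact: indecomposable_level.
rewrite mem_part => /eqP eq_uz zu.
have lt_yz : level y < level z by rewrite -eq_uz.
rewrite twins_uy // ?neq_level ?gtn_eqF // e_sym edge_below //.
by rewrite /in_clique -eq_uz.
Qed.

Lemma twins_lower_singleton : part (level y) = [set y].
Proof.
have ind_y := @indecomposable_level y.
apply: (indecomposable_uniform (b := in_clique u) e_irr ind_y (in_part y)) => z.
rewrite mem_part => /eqP eq_yz zy.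
have lt_zu : level z < level u by rewrite -eq_yz.
by rewrite -twins_uy ?edge_below // neq_level // ltn_eqF.
Qed.

Lemma twins_in_clique z :
  level y < level z <= level u -> in_clique z = in_clique u.
Proof.
case/andP=> lt_yz; rewrite leq_eqVlt => /orP[/eqP eq_zu|lt_zu].
  by have := in_part z; rewrite eq_zu twins_upper_singleton => /set1P->.
have zy : z != y by rewrite neq_level // gtn_eqF.
have zu : z != u by rewrite neq_level // ltn_eqF.
by rewrite -(edge_below lt_yz) e_sym -twins_uy // edge_below.
Qed.

Lemma twins_inner_singleton z :
  level y < level z <= level u -> part (level z) = [set z].
Proof.
move=> z_mid; have z_gt0 : 0 < level z.
  by case/andP: z_mid => lt_yz _; apply: leq_ltn_trans lt_yz.
have ind_z := @indecomposable_level z.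
apply: (indecomposable_uniform (b := in_clique z) e_irr ind_z (in_part z)) => w.
rewrite mem_part => /eqP eq_zw wz.
by rewrite edge_level // 1?eq_sym // !twins_in_clique // -eq_zw.
Qed.

Lemma twins_lower_in_clique : 0 < level y -> in_clique y = in_clique u.
Proof.
move=> y_gt0; have [w w0] := level_surj (ltn0Sn _).
have [lt_wy lt_wu] : level w < level y /\ level w < level u.
  by rewrite w0 y_gt0 (ltn_trans y_gt0).
by rewrite -(edge_below lt_wy) -twins_uy ?edge_below // neq_level // ltn_eqF.
Qed.

Lemma twins_type i :
  level y <= i <= level u -> level_type i = Some (in_clique u).
Proof.
have type_mid j : level y < j <= level u -> level_type j = Some (in_clique u).
  move=> j_mid; have [_ le_ju] := andP j_mid.
  have [z z_j] := level_surj (leq_ltn_trans le_ju (level_lt u)).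
  rewrite -{}z_j in j_mid *; rewrite level_type_singleton ?twins_in_clique //.
    by case/andP: j_mid => lt_yz _; apply: leq_ltn_trans lt_yz.
  exact: twins_inner_singleton.
case/andP; rewrite leq_eqVlt => /predU1P[<- _|lt_yi le_iu]; last first.
  by rewrite type_mid ?lt_yi.
have [y0|y_gt0] := posnP (level y); last first.
  by rewrite level_type_singleton ?twins_lower_singleton ?twins_lower_in_clique.
have := twins_lower_singleton; rewrite y0 => /level_type0->.
by rewrite type_mid // y0; move: lt_yu; rewrite y0.
Qed.

End TwinLevels.

(** * Compact components *)

Definition compact_level x := run_index (map fst (items comps V0)) (level x).

Lemma eq_degree_compact_level u y :
  #|nbhd e u| = #|nbhd e y| -> compact_level u = compact_level y.
Proof.
wlog lt_yu : u y / level y < level u => [wlog_lt eq_deg|eq_deg].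
  have [lt_uy|lt_yu|eq_uy] := ltngtP (level u) (level y).
  - exact/esym/wlog_lt.
  - exact: wlog_lt.
  by rewrite /compact_level eq_uy.
apply/esym/run_index_const; first exact: ltnW.
exact/twins_type/eq_degree_twins.
Qed.

Lemma item_set_items : map (@item_set T) (items comps V0) = parts comps V0.
Proof. by rewrite /item_set /= setU0 -map_comp. Qed.

Lemma block_count_compact_parts x : block_count (compact_parts comps V0) x = 1.
Proof.
have [_ _ cnt _] := decomp.
by rewrite [LHS]block_count_compress item_set_items [block_count _ _]cnt.
Qed.

Lemma mem_compact_part x k : (x \in compact_part k) = (k == compact_level x).
Proof.
rewrite /compact_level /level -item_set_items -block_index_compress.
exact/mem_nth_block/block_count_compact_parts.
Qed.

Lemma in_compact_part x : x \in compact_part (compact_level x).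
Proof. by rewrite mem_compact_part. Qed.

Lemma mem_compact_parts x :
  compact_part (compact_level x) \in compact_parts comps V0.
Proof.
apply: mem_nth; rewrite ltnNge; apply/negP => le_k.
by have := in_compact_part x; rewrite nth_default ?inE.
Qed.

Lemma compact_parts_disjoint :
  pairwise (fun V U : {set T} => [disjoint V & U]) (compact_parts comps V0).
Proof.
apply/(pairwiseP set0) => i j _ _ lt_ij; rewrite disjoint_subset.
by apply/subsetP => x; rewrite inE !mem_compact_part => /eqP<-; rewrite gtn_eqF.
Qed.

Lemma bigcup_compact_parts : \bigcup_(V <- compact_parts comps V0) V = [set: T].
Proof.
apply/setP => x; rewrite bigcup_seq inE; apply/bigcupP.
exists (compact_part (compact_level x)); first exact: mem_compact_parts.
exact: in_compact_part.
Qed.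

Lemma graph_aut_local_aut p V :
  p \in graph_aut e -> V \in compact_parts comps V0 -> p \in local_aut e V.
Proof.
move=> pe /(nthP set0)[k _ <-].
apply/local_autP; split=> [x|x y _ _]; last exact: graph_autP.
by rewrite !mem_compact_part (eq_degree_compact_level (card_nbhd_aut x pe)).
Qed.

Section Gluing.

Variable p : {perm T}.
Hypothesis p_local :
  forall V, V \in compact_parts comps V0 -> p \in local_aut e V.

Lemma local_aut_compact_level x : compact_level (p x) = compact_level x.
Proof.
have /local_autP[pV _] := p_local (mem_compact_parts x).
by apply/esym/eqP; rewrite -mem_compact_part pV in_compact_part.
Qed.

Lemma untyped_compact_part x : level_type (level x) = None ->
  compact_part (compact_level x) = part (level x).
Proof.
move=> tx; apply/setP => z; rewrite mem_compact_part mem_part.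
apply/eqP/eqP => [/run_index_inj_None->|eq_xz] //.
by rewrite /compact_level eq_xz.
Qed.

Lemma local_aut_in_clique x : 0 < level x -> 0 < level (p x) ->
  in_clique (p x) = in_clique x.
Proof.
move=> x_gt0 px_gt0; have eq_px := local_aut_compact_level x.
have eq_type := run_index_nth eq_px.
case tx: (level_type (level x)) eq_type => [b|] eq_type.
  rewrite (level_type_in_clique x_gt0 tx).
  exact: level_type_in_clique px_gt0 eq_type.
have p_part := p_local (mem_compact_parts x).
rewrite untyped_compact_part // in p_part.
rewrite /in_clique (run_index_inj_None eq_type eq_px).
apply: (indecomposable_aut_ks e_sym _ (ks_part_level x_gt0) p_part (in_part x)).
exact: indecomposable_level.
Qed.

Lemma local_auts_graph_aut : p \in graph_aut e.
Proof.
have lower x y : compact_level y < compact_level x -> level y < level x.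
  by rewrite !ltnNge; apply: contra; apply: leq_run_index.
have edge_lower x y : compact_level y < compact_level x ->
    e (p x) (p y) = e x y.
  move=> lt_compact; have lt_yx := lower x y lt_compact.
  have lt_pyx : level (p y) < level (p x).
    by rewrite lower ?local_aut_compact_level.
  rewrite (edge_below lt_yx) (edge_below lt_pyx) local_aut_in_clique //.
    exact: leq_ltn_trans lt_yx.
  exact: leq_ltn_trans lt_pyx.
apply/graph_autP => x y.
have [lt_xy|lt_yx|eq_xy] := ltngtP (compact_level x) (compact_level y).
- by rewrite e_sym edge_lower // e_sym.
- exact: edge_lower.
have /local_autP[_ ->//] := p_local (mem_compact_parts x).
  exact: in_compact_part.
by rewrite mem_compact_part eq_xy.
Qed.

End Gluing.

Lemma bigcap_local_aut :
  \bigcap_(V <- compact_parts comps V0) local_aut e V = graph_aut e.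
Proof.
apply/eqP; rewrite bigcap_seq eqEsubset; apply/andP; split.
  by apply/subsetP => p /bigcapP p_local; apply: local_auts_graph_aut.
apply/bigcapsP => V mem_V; apply/subsetP => p pe.
exact: graph_aut_local_aut.
Qed.

End Decomposition.

Theorem mainTheorem6 (T : finType) (e : rel T)
    (e_sym : symmetric e) (e_irr : irreflexive e)
    (comps : seq ({set T} * {set T})) (V0 : {set T}) :
  canonical_decomp e comps V0 ->
  [/\ (forall p, p \in graph_aut e -> forall V, V \in compact_parts comps V0 -> p @: V = V),
      (forall p, p \in graph_aut e -> forall V, V \in compact_parts comps V0 ->
         exists2 s, s \in aut_on e V & {in V, s =1 p}) &
      (\big[dprod/1]_(V <- compact_parts comps V0) aut_on e V)%g = graph_aut e].
Proof.
case=> decomp indec.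
have local := graph_aut_local_aut e_sym e_irr decomp indec.
split=> [p pe V mem_V|p pe V mem_V|].
- by have /setIdP[/astabs_setact] := local p V pe mem_V.
- exists (restr_perm V p); first exact/restr_perm_aut_on/local.
  move=> x xV; apply: restr_permE => //.
  by have /setIdP[] := local p V pe mem_V.
rewrite bigdprod_aut_on ?(compact_parts_disjoint decomp) //.
rewrite (bigcup_compact_parts decomp) SymT setTI.
exact: bigcap_local_aut.
Qed.
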